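(* Let $G$ be a minimally $3$-connected graph on $n\ge 7$ vertices. Then $|E(G)|\le 3n-9$. Moreover, if $n\ge 8$, then $|E(G)| = 3n-9$ if and only if $G\cong K_{3,n-3}$; and if $n\ge 9$, then $|E(G)| = 3n-10$ if and only if $G\cong K^{\perp}_{3,n-4}$.
   Context: Graphs are finite. A graph with at least 4 vertices is $3$-connected if at least 3 vertices must be removed to disconnect it; by convention $K_4$ is $3$-connected. An edge $e$ of a $3$-connected graph $G$ is deletable if $G\backslash e$ (deletion of $e$) is $3$-connected; a $3$-connected graph is minimally $3$-connected if it has no deletable edges. For $p\ge 3$, $K^{\perp}_{3,p}$ is the graph on $p+4$ vertices with $3p+2$ edges defined as follows: take $K_{3,p}$ with vertex classes $\{a,b,c\}$ and $\{u_1,\dots,u_p\}$, add the edge $ab$, and then split $a$ into two adjacent vertices $a$ and $a'$, where $a'$ has degree 3 and is adjacent to $a$, $b$ and $u_1$, and $a$ keeps its edges to $u_2,\dots,u_p$ (so $a$ is no longer adjacent to $b$ or $u_1$). Equivalently, subdivide the edge $au_1$ of $K_{3,p}$ with a new vertex $a'$ and add the edge $a'b$. *)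

(* Defs.v *)
From mathcomp Require Import all_boot.

Set Implicit Arguments.
Unset Strict Implicit.
Unset Printing Implicit Defensive.

Record sgraph := SGraph {
  vertex :> finType;
  adj : rel vertex;
  adj_sym : symmetric adj;
  adj_irrefl : irreflexive adj }.

Definition edges (G : sgraph) : {set {set G}} :=
  [set A | [exists x : G, exists y : G, adj x y && (A == [set x; y])]].

Section Deletion.
Variables (G : sgraph) (A : {set G}).

Definition del_adj : rel G := [rel x y | adj x y && ([set x; y] != A)].

Lemma del_adj_sym : symmetric del_adj.
Proof. by move=> x y; rewrite /del_adj /= adj_sym setUC. Qed.

Lemma del_adj_irrefl : irreflexive del_adj.
Proof. by move=> x; rewrite /del_adj /= adj_irrefl. Qed.

Definition del_edge : sgraph := SGraph del_adj_sym del_adj_irrefl.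

End Deletion.

Definition disconnecting (G : sgraph) (S : {set G}) : Prop :=
  exists x y : G, [/\ x \notin S, y \notin S &
    ~~ connect [rel u v | [&& adj u v, u \notin S & v \notin S]] x y].

(* A complete graph has no disconnecting set, so K_4 (and every larger
   complete graph) is 3-connected. *)
Definition three_connected (G : sgraph) : Prop :=
  4 <= #|G| /\ forall S : {set G}, disconnecting S -> 3 <= #|S|.

Definition deletable (G : sgraph) (A : {set G}) : Prop :=
  A \in edges G /\ three_connected (del_edge A).

Definition minimally_three_connected (G : sgraph) : Prop :=
  three_connected G /\ forall A : {set G}, ~ deletable A.

Definition isomorphic (G H : sgraph) : Prop :=
  exists f : G -> H, bijective f /\ forall x y, adj (f x) (f y) = adj x y.

Section CompleteBipartite.
Variables m p : nat.

Definition biclique_adj : rel ('I_m + 'I_p) := fun x y =>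
  match x, y with
  | inl _, inr _ | inr _, inl _ => true
  | _, _ => false
  end.

Lemma biclique_adj_sym : symmetric biclique_adj.
Proof. by move=> [i|j] [i'|j']. Qed.

Lemma biclique_adj_irrefl : irreflexive biclique_adj.
Proof. by case. Qed.

Definition biclique : sgraph := SGraph biclique_adj_sym biclique_adj_irrefl.

End CompleteBipartite.

(* K^perp_{3,p}: [None] is a'; [inl] 0, 1, 2 are a, b, c; [inr j] is
   u_(j+1).  Meaningful for 0 < p only, since u_1 must exist. *)
Section KPerp.
Variable p : nat.

Definition kperp_adj : rel (option ('I_3 + 'I_p)) := fun x y =>
  match x, y with
  | None, Some (inl i) | Some (inl i), None => (i == 0 :> nat) || (i == 1 :> nat)
  | None, Some (inr j) | Some (inr j), None => j == 0 :> nat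
  | Some (inl i), Some (inr j) | Some (inr j), Some (inl i) =>
      ~~ ((i == 0 :> nat) && (j == 0 :> nat))
  | _, _ => false
  end.

Lemma kperp_adj_sym : symmetric kperp_adj.
Proof. by move=> [[i|j]|] [[i'|j']|]. Qed.

Lemma kperp_adj_irrefl : irreflexive kperp_adj.
Proof. by move=> [[i|j]|]. Qed.

Definition kperp : sgraph := SGraph kperp_adj_sym kperp_adj_irrefl.

End KPerp.

(* Main.v *)
Require Import Defs.
From mathcomp Require Import all_boot zify.

Set Implicit Arguments.
Unset Strict Implicit.
Unset Printing Implicit Defensive.

(** Call a vertex big if its degree is at least 4 and small if its degree is
    3, and let [f] and [t = n - f] be the numbers of big and small vertices.
    Counting ordered pairs of adjacent vertices gives
      2 |E| + arcs small small = 6 t + arcs big big   ([edge_count]),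
    so a graph with many edges has few edges between small vertices and many
    between big ones.  The big vertices cannot contribute much: they induce a
    forest ([forest_big]).  This is the case of connectivity 3 of Mader's
    theorem that every cycle of a minimally k-connected graph contains a
    vertex of degree k.  Its proof ([no_cycle_deg_ge4]) uses that an edge [xy]
    whose deletion destroys 3-connectivity gives a split of the graph: two
    vertices separate [x] from [y] once [xy] is deleted
    ([edge_split_exists]).  Two splits on consecutive edges of a cycle of big
    vertices can be uncrossed, because a corner with a boundary of at most one
    vertex forces the middle vertex to have degree 3 ([corner_deg]).
    Following the cycle, the far side of the split then shrinks for ever.

    With the forest bound, [f >= 5] gives |E| <= 3n - 11, and the remaining
    cases are driven by connectivity.  If [f <= 1], each small vertex has at
    least two small neighbours ([edges_big_le1]).  If [f = 2], the small
    vertices induce a connected graph ([edges_big_2]).  If [f = 3] and two big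
    vertices are adjacent, the small vertices have at most two components,
    because each component is attached to all big vertices and so has to meet
    the separator of the split of that edge ([edges_big_3]).  In these cases
    there are enough edges between small vertices for |E| <= 2n - 2.  If
    [f = 4], more than one edge between big vertices is incompatible with
    having many components on the small vertices ([four_big_arcs]), because
    the split of such an edge [ab] leaves every component attached to all big
    vertices but exactly one of [a] and [b].  In each of these cases
    |E| <= 3n - 9, with |E| < 3n - 9 when n >= 8 and |E| < 3n - 10 when n >= 9
    ([edges_shape]).

    There remains [f = 3] with no edge between big vertices, where
    |E| = 3n - 9 - m with [m] the number of edges between small vertices.
    For [m = 0] every small vertex is joined to all three big ones, which is
    the complete bipartite graph ([iso_biclique]).  For [m = 1] the two ends of
    the small edge miss different big vertices, since otherwise the other two
    would separate them from the rest, and this is the graph with the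
    subdivided edge ([iso_kperp]). *)

(** * Counting *)

Lemma card_indicator (T : finType) (X : {set T}) : #|X| = \sum_z (z \in X).
Proof. by rewrite -sum1_card big_mkcond. Qed.

Lemma disjoint_absurd (T : finType) (X Y : {set T}) u :
  [disjoint X & Y] -> u \in X -> u \in Y -> False.
Proof. by move=> dXY uX; rewrite (disjointFr dXY uX). Qed.

Lemma disjointIF (T : finType) (X Y : {set T}) u :
  [disjoint X & Y] -> (u \in X) && (u \in Y) = false.
Proof. by move=> dXY; apply/negP => /andP[/(disjoint_absurd dXY)]. Qed.

(** Sizes of the corners of two crossing partial bipartitions.  The first
    lemma is the submodularity of the boundary; the second measures
    a corner boundary when the opposite corner is empty.  Both compare,
    vertex by vertex, the cells of the three by three diagram. *)
Section Uncross.
Variables (T : finType) (A1 B1 A2 B2 : {set T}).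
Hypotheses (d1 : [disjoint A1 & B1]) (d2 : [disjoint A2 & B2]).

Lemma card_uncross :
  #|~: (B1 :|: B2) :\: (A1 :&: A2)| + #|~: (A1 :|: A2) :\: (B1 :&: B2)| <=
    #|~: (A1 :|: B1)| + #|~: (A2 :|: B2)|.
Proof.
rewrite !card_indicator -!big_split /=; apply: leq_sum => v _; rewrite !inE.
have := disjointIF v d1; have := disjointIF v d2.
by do 4!case: (v \in _).
Qed.

Lemma card_uncross_eq : [disjoint A1 & B2] ->
  #|~: (A1 :|: B2) :\: (B1 :&: A2)| + #|B2| + #|B1 :&: A2| =
    #|~: (A1 :|: B1)| + #|B1|.
Proof.
move=> d; rewrite !card_indicator -!big_split /=; apply: eq_bigr => v _; rewrite !inE.
have := disjointIF v d1; have := disjointIF v d2; have := disjointIF v d.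
by do 4!case: (v \in _).
Qed.

End Uncross.

Section Arcs.
Variable G : sgraph.
Implicit Types (x y u v z : G) (X Y Z N A B S C : {set G}).

Definition nb x : {set G} := [set y | adj x y].

Definition arc_set X Y : {set G * G} :=
  [set p in setX X Y | adj p.1 p.2].

(** Edges are counted as ordered pairs, so that an edge inside [X] is counted
    twice in [arcs X X] and all the counts below are additive. *)
Definition arcs X Y := #|arc_set X Y|.

Lemma nbC x y : (y \in nb x) = (x \in nb y).
Proof. by rewrite !inE adj_sym. Qed.

Lemma nb_irr x : (x \in nb x) = false.
Proof. by rewrite inE adj_irrefl. Qed.

Lemma arcs_nb X Y : arcs X Y = \sum_(x in X) #|nb x :&: Y|.
Proof.
rewrite /arcs -sum1_card.
under [RHS]eq_bigr do rewrite -sum1_card.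
rewrite pair_big_dep /=; apply: eq_bigl => -[x y] /=.
by rewrite !inE /= -andbA; congr (_ && _); rewrite andbC.
Qed.

Lemma arcs_sum X Y :
  arcs X Y = \sum_x \sum_y [&& x \in X, y \in Y & adj x y].
Proof.
rewrite /arcs card_indicator pair_big /=.
by apply: eq_bigr => -[x y] _; rewrite !inE /= -andbA.
Qed.

Lemma arcsC X Y : arcs X Y = arcs Y X.
Proof.
rewrite !arcs_sum exchange_big /=; apply: eq_bigr => x _.
by apply: eq_bigr => y _; rewrite adj_sym andbCA.
Qed.

Lemma arcsDl X X' Y :
  X \subset X' -> arcs X' Y = arcs X Y + arcs (X' :\: X) Y.
Proof.
move=> /subsetP sX; rewrite !arcs_sum -big_split; apply: eq_bigr => x _ /=.
rewrite -big_split; apply: eq_bigr => y _ /=; rewrite inE.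
by case: (boolP (x \in X)) => [/sX ->|_] //=; rewrite addn0.
Qed.

Lemma arcsDr X Y Y' :
  Y \subset Y' -> arcs X Y' = arcs X Y + arcs X (Y' :\: Y).
Proof. by move=> sY; rewrite arcsC (arcsDl _ sY) !(arcsC _ X). Qed.

Lemma arcsS X X' Y Y' :
  X \subset X' -> Y \subset Y' -> arcs X Y <= arcs X' Y'.
Proof.
move=> sX sY; rewrite (arcsDl Y' sX) (arcsDr X sY) -addnA; exact: leq_addr.
Qed.

Lemma arcs_subadd X Y Z : [disjoint X & Y] -> X \subset Z -> Y \subset Z ->
  arcs X X + arcs Y Y <= arcs Z Z.
Proof.
move=> dXY sX sY; rewrite (arcsDl Z sX) leq_add ?arcsS //.
by rewrite subsetD sY disjoint_sym.
Qed.

Lemma size_arcs (s : seq (G * G)) X Y : uniq s ->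
  {in s, forall p, [/\ p.1 \in X, p.2 \in Y & adj p.1 p.2]} ->
  size s <= arcs X Y.
Proof.
move=> /card_uniqP <- sP; apply/subset_leq_card/subsetP => p /sP[pX pY pA].
by rewrite !inE pX pY pA.
Qed.

Lemma arcs_gt0P X Y :
  reflect (exists x y, [/\ x \in X, y \in Y & adj x y]) (0 < arcs X Y).
Proof.
rewrite /arcs; apply: (iffP card_gt0P) => [[[x y]]|[x [y [xX yY xy]]]].
  by rewrite !inE /= => /andP[/andP[xX yY] xy]; exists x, y.
by exists (x, y); rewrite !inE /= xX yY xy.
Qed.

Lemma arcs_eq0 X Y x y :
  arcs X Y = 0 -> x \in X -> y \in Y -> adj x y = false.
Proof.
move=> a0 xX yY; apply/negP => xy.
suff: 0 < arcs X Y by rewrite a0.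
by apply/arcs_gt0P; exists x, y.
Qed.

Lemma handshake : 2 * #|edges G| = arcs setT setT.
Proof.
rewrite /arcs -[RHS]sum1_card.
rewrite (partition_big (fun p : G * G => [set p.1; p.2]) (mem (edges G))) /=.
  rewrite mulnC -sum_nat_const; apply: eq_bigr => A.
  rewrite inE => /existsP[x /existsP[y /andP[xy /eqP ->]]].
  have nxy : x != y by apply: contraL xy => /eqP ->; rewrite adj_irrefl.
  have ne : (x, y) != (y, x) by rewrite xpair_eqE negb_and nxy.
  rewrite sum1_card -(_ : #|[set (x, y); (y, x)]| = 2); last by rewrite cards2 ne.
  apply/esym/eq_card => -[u v]; rewrite !inE /= -topredE /= !inE /= !xpair_eqE.
  apply/andP/orP => [[uv /eqP E]|[/andP[/eqP -> /eqP ->]|/andP[/eqP -> /eqP ->]]].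
  - have nuv : u != v by apply: contraL uv => /eqP ->; rewrite adj_irrefl.
    have: u \in [set x; y] by rewrite -E !inE eqxx.
    have: v \in [set x; y] by rewrite -E !inE eqxx orbT.
    rewrite !inE => /orP[]/eqP ev /orP[]/eqP eu; move: nuv;
      by rewrite eu ev ?eqxx ?orbT //; auto.
  - by rewrite xy.
  - by rewrite adj_sym xy setUC.
by move=> [x y]; rewrite !inE /= => xy; apply/existsP; exists x;
  apply/existsP; exists y; rewrite xy eqxx.
Qed.

Lemma handshake_sum : 2 * #|edges G| = \sum_(x : G) \sum_(y : G) adj x y.
Proof.
rewrite handshake arcs_sum.
by apply: eq_bigr => x _; apply: eq_bigr => y _; rewrite !inE.
Qed.

End Arcs.

(** * Connectivity and the critical splits *)

Section Connectivity.
Variable G : sgraph.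
Implicit Types (a b c p q r s x y u v w z : G) (X Y Z N A B S C : {set G}).
Hypothesis G3 : three_connected G.

(** 3-connectivity as a bound on the boundary of a set of vertices; [z]
    witnesses that the boundary separates [X] from something. *)
Lemma cut_ge3 X N z :
  X != set0 -> z \notin X -> z \notin N ->
  (forall u v, u \in X -> v \notin X -> adj u v -> v \in N) ->
  [disjoint X & N] -> 3 <= #|N|.
Proof.
move=> /set0Pn[x xX] zX zN exitX dXN; apply: G3.2; exists x, z; split=> //.
  by rewrite (disjointFr dXN xX).
apply/negP => /closed_connect cl; move: zX; rewrite -(cl (mem X)) ?xX //.
move=> u v /= /and3P[uv uN vN]; apply/idP/idP => [uX|vX].
  by apply: contraNT vN => vX; exact: exitX uv.
by apply: contraNT uN => uX; apply: exitX vX uX _; rewrite adj_sym.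
Qed.

Lemma deg_ge3 x : 3 <= #|nb x|.
Proof.
rewrite leqNgt; apply/negP => d2; have: 0 < #|~: (x |: nb x)|.
  have := cardsC (x |: nb x); have := G3.1; have := cardsU1 x (nb x).
  by rewrite nb_irr /=; lia.
case/card_gt0P => z; rewrite !inE negb_or => /andP[zx xz].
move: d2; apply/negP; rewrite -leqNgt.
apply: (@cut_ge3 [set x] _ z); rewrite ?inE //.
- by apply/set0Pn; exists x; rewrite inE.
- by move=> u v; rewrite !inE => /eqP ->.
- by rewrite disjoints1 nb_irr.
Qed.

(** If [X] had a vertex other than [y], then [y] and [N] would cut [X :\ y]
    off, and they are at most two vertices.  Hence [X] is [y] alone, and its
    neighbours are among [x], [w] and the vertex of [N]. *)
Lemma corner_deg X N x w y z :
  y \in X -> z \notin X -> z \notin N -> [disjoint X & N] -> #|N| <= 1 ->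
  (forall u v, u \in X -> v \notin X -> adj u v ->
     v \in N \/ u = y /\ (v = x \/ v = w)) ->
  #|nb y| <= 3.
Proof.
move=> yX zX zN dXN N1 exitX.
have [X1|nX1] := eqVneq (X :\ y) set0.
  have sub : nb y \subset x |: (w |: N).
    apply/subsetP => v; rewrite inE => yv.
    have vX : v \notin X.
      apply: contraL yv => vX; have: v \notin X :\ y by rewrite X1 in_set0.
      by rewrite in_setD1 vX andbT negbK => /eqP ->; rewrite adj_irrefl.
    rewrite !inE; case: (exitX _ _ yX vX yv) => [->|[_ [->|->]]];
      by rewrite ?eqxx ?orbT.
  have := subset_leq_card sub; rewrite !cardsU1.
  by move: N1; clear; case: (_ \notin _); case: (_ \notin _); lia.
have: 3 <= #|y |: N|.
  apply: (@cut_ge3 (X :\ y) _ z nX1).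
  - by rewrite inE (negbTE zX) andbF.
  - by rewrite !inE negb_or zN andbT; apply: contraNneq zX => ->.
  - move=> u v /setD1P[uy uX]; rewrite !inE negb_and negbK.
    case/orP=> [->//|vX] uv; case: (exitX u v uX vX uv) => [->|[ey _]].
      by rewrite orbT.
    by rewrite ey eqxx in uy.
  - rewrite disjoints_subset; apply/subsetP => u /setD1P[uy uX].
    by rewrite in_setC in_setU1 negb_or uy (disjointFr dXN uX).
by rewrite cardsU1; move: N1; clear; case: (_ \notin _); lia.
Qed.

(** The separation that makes an edge [xy] critical: the separator is the
    complement of [A] and [B] rather than a third argument. *)
Definition edge_split x y A B :=
  [/\ x \in A, y \in B, [disjoint A & B], #|~: (A :|: B)| <= 2 &
      forall u v, u \in A -> v \in B -> adj u v -> u = x /\ v = y].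

Lemma edge_splitC x y A B : edge_split x y A B -> edge_split y x B A.
Proof.
case=> xA yB dAB S2 AB; split=> //; first by rewrite disjoint_sym.
  by rewrite setUC.
by move=> u v uB vA uv; rewrite adj_sym in uv; have [-> ->] := AB _ _ vA uB uv.
Qed.

(** Two vertices separate the graph without [xy].  They do not separate the
    graph itself, so [xy] is the one edge that joins the component [P] of one
    side to the remaining vertices. *)
Lemma edge_split_exists x y :
  (forall A, ~ deletable A) -> adj x y -> exists A B, edge_split x y A B.
Proof.
move=> crit xy; pose e := [set x; y].
pose r S := [rel u v | [&& adj u v && ([set u; v] != e), u \notin S & v \notin S]].
have eE : e \in edges G.
  by rewrite inE; apply/existsP; exists x; apply/existsP; exists y; rewrite xy eqxx.
have [/existsP[S /andP[S2 /existsP[p /existsP[q /and3P[pS qS npq]]]]]|noS] :=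
  boolP [exists S : {set G}, (#|S| < 3) && [exists p, exists q,
      [&& p \notin S, q \notin S & ~~ connect (r S) p q]]]; last first.
  case: (crit e); split=> //; split; first exact: G3.1.
  move=> S [p [q [pS qS npq]]]; rewrite leqNgt; apply: contra noS => S3.
  apply/existsP; exists S; rewrite S3; apply/existsP; exists p; apply/existsP.
  by exists q; rewrite pS qS.
pose P := [set z | connect (r S) p z].
have PS z : z \in P -> z \notin S.
  rewrite inE => /connectP[s sP ->]; elim/last_ind: s sP => // s t _.
  by rewrite rcons_path last_rcons => /andP[_ /and3P[]].
have pP : p \in P by rewrite inE connect0.
have qP : q \notin P by rewrite inE.
have stepP u v : u \in P -> v \notin P -> v \notin S -> adj u v ->
    u = x /\ v = y \/ u = y /\ v = x.
  move=> uP vP vS uv; have uS := PS _ uP.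
  have [E|ne] := eqVneq [set u; v] e.
    have nuv : u != v by apply: contraL uv => /eqP ->; rewrite adj_irrefl.
    have: u \in e by rewrite -E !inE eqxx.
    have: v \in e by rewrite -E !inE eqxx orbT.
    rewrite !inE => /orP[]/eqP ev /orP[]/eqP eu; move: nuv;
      by rewrite eu ev ?eqxx //; auto.
  case/negP: vP; rewrite inE; move: uP; rewrite inE => /connect_trans; apply.
  by apply: connect1; rewrite /= uv ne uS.
have split_cross a b : a \in P -> b \notin P -> b \notin S -> adj a b ->
    edge_split a b P (~: (P :|: S)).
  move=> aP bP bS ab; split=> //.
  - by rewrite in_setC in_setU negb_or bP.
  - by rewrite disjoints_subset setCK subsetUl.
  - apply: leq_trans (_ : #|S| <= 2) => //; apply/subset_leq_card/subsetP => z.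
    by rewrite !in_setC !in_setU in_setC negb_or negbK in_setU; case: (z \in P).
  - move=> u v uP; rewrite in_setC in_setU negb_or => /andP[vP vS] uv.
    have [[eu ev]|[eu ev]] := stepP _ _ uP vP vS uv;
      have [[ea eb]|[ea eb]] := stepP _ _ aP bP bS ab; rewrite eu ev ea eb //;
      by move: bP; rewrite eb -eu uP.
have [/existsP[u /existsP[v /and4P[uP vP vS uv]]]|noX] :=
  boolP [exists u, exists v, [&& u \in P, v \notin P, v \notin S & adj u v]].
  have := split_cross _ _ uP vP vS uv.
  case: (stepP _ _ uP vP vS uv) => [[-> ->] sp|[-> -> /edge_splitC sp]].
    by exists P, (~: (P :|: S)).
  by exists (~: (P :|: S)), P.
have: 3 <= #|S|; last by rewrite leqNgt S2.
apply: (@cut_ge3 P S q) => //.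
- by apply/set0Pn; exists p.
- move=> u v uP vP uv; apply: contraNT noX => vS.
  by apply/existsP; exists u; apply/existsP; exists v; rewrite uP vP vS.
- by apply/pred0P => z /=; apply/negP => /andP[/PS/negP].
Qed.

(** * The vertices of degree at least 4 induce a forest *)

(** If the far sides of two splits at [y] met, their intersection would have a
    boundary of at least three vertices, as its edges avoid both split edges.
    By submodularity the opposite corner, which contains [y], would have
    a boundary of at most one vertex, against [corner_deg]. *)
Lemma splits_disjoint y x w A1 B1 A2 B2 :
  4 <= #|nb y| -> x != w -> adj y x -> adj y w ->
  edge_split y x A1 B1 -> edge_split y w A2 B2 -> [disjoint B1 & B2].
Proof.
move=> dy xw yx yw [yA1 xB1 dAB1 S1 AB1] [yA2 wB2 dAB2 S2 AB2].
apply/pred0P => z /=; apply/negP => /andP[zB1 zB2].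
have nAB1 := disjoint_absurd dAB1; have nAB2 := disjoint_absurd dAB2.
pose W := ~: (A1 :|: A2) :\: (B1 :&: B2).
pose U := ~: (B1 :|: B2) :\: (A1 :&: A2).
have UW : #|U| + #|W| <= #|~: (A1 :|: B1)| + #|~: (A2 :|: B2)|
  by exact: card_uncross.
have W3 : 3 <= #|W|.
  apply: (@cut_ge3 (B1 :&: B2) W y).
  - by apply/set0Pn; exists z; rewrite inE zB1.
  - by rewrite inE; apply/negP => /andP[yB1 _]; exact: nAB1 yB1.
  - by rewrite in_setD in_setC in_setU yA1 andbF.
  - move=> u v /setIP[uB1 uB2] vB uv; rewrite in_setD vB /= in_setC in_setU.
    apply/norP; split; apply/negP => vA; rewrite adj_sym in uv.
      have [ev eu] := AB1 _ _ vA uB1 uv; subst u v.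
      by have [_ e] := AB2 _ _ yA2 uB2 uv; rewrite e eqxx in xw.
    have [ev eu] := AB2 _ _ vA uB2 uv; subst u v.
    by have [_ e] := AB1 _ _ yA1 uB1 uv; rewrite e eqxx in xw.
  - by rewrite disjoint_sym disjoints_subset subsetDr.
move: dy; apply/negP; rewrite -leqNgt.
apply: (@corner_deg (A1 :&: A2) U x w y z).
- by rewrite inE yA1.
- by apply/negP => /setIP[/nAB1/(_ zB1)].
- by rewrite !inE zB1 andbF.
- by rewrite disjoint_sym disjoints_subset subsetDr.
- by move: UW W3 S1 S2; clear; lia.
- move=> u v /setIP[uA1 uA2] vA uv; rewrite in_setD vA in_setC in_setU.
  have [vB1|_] := boolP (v \in B1).
    by have [-> ->] := AB1 _ _ uA1 vB1 uv; auto.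
  have [vB2|_] := boolP (v \in B2); last by left.
  by have [-> ->] := AB2 _ _ uA2 vB2 uv; auto.
Qed.

Hypothesis crit : forall A, ~ @deletable G A.

(** Mader's theorem for connectivity 3, in the form that gives a forest by
    removing vertices one at a time.  If every vertex of [C] had two neighbours
    in [C], take a split of an edge [xy] in [C] with far side [B1], and
    continue along another edge [yw] in [C] to a split with far side [B3].
    The near side [A1] does not meet [B3] by [splits_disjoint], so
    if [B3] is not smaller than [B1] then the corner [B1 :&: A3] around [y] has
    a boundary of at most one vertex, against [corner_deg].  So the far side
    gets smaller at each step. *)
Lemma no_cycle_deg_ge4 C : C != set0 ->
  {in C, forall x, 4 <= #|nb x|} -> exists2 x, x \in C & #|nb x :&: C| <= 1.
Proof.
move=> /set0Pn[x0 x0C] C4.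
have [/existsP[x /andP[xC dx]]|no1] :=
  boolP [exists x, (x \in C) && (#|nb x :&: C| <= 1)]; first by exists x.
have C2 x : x \in C -> 2 <= #|nb x :&: C|.
  move=> xC; rewrite leqNgt; apply: contra no1 => dx; apply/existsP; exists x.
  by rewrite xC.
suff desc m x y A B : x \in C -> y \in C -> adj x y -> edge_split x y A B ->
    #|B| <= m -> False.
  have /card_gt0P[y] : 0 < #|nb x0 :&: C| by have := C2 _ x0C; lia.
  rewrite !inE => /andP[xy yC].
  have [A [B sp]] := edge_split_exists crit xy.
  by case: (desc #|B| _ _ _ _ x0C yC xy sp).
elim: m x y A B => [|m IH] x y A1 B1 xC yC xy sp1 B1m.
  by case: sp1 => _ yB _ _ _; move: B1m; rewrite leqn0 cards_eq0 => /eqP B0; rewrite B0 inE in yB.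
have [w [wx yw wC]] : exists w, [/\ w != x, adj y w & w \in C].
  have: 0 < #|nb y :&: C :\ x|.
    by move: (C2 _ yC); rewrite (cardsD1 x); clear; case: (_ \in _); lia.
  case/card_gt0P => w; rewrite !inE => /and3P[wx yw wC]; by exists w.
have [A3 [B3 sp3]] := edge_split_exists crit yw.
have [B31|B13] := ltnP #|B3| #|B1|; first by apply: (IH y w A3 B3) => //; exact: leq_trans B31 B1m.
have yx : adj y x by rewrite adj_sym.
have dAB := splits_disjoint (C4 _ yC) (_ : x != w) yx yw (edge_splitC sp1) sp3.
have {dAB} : [disjoint A1 & B3] by apply: dAB; rewrite eq_sym.
case: sp1 sp3 => xA1 yB1 dAB1 S1 AB1 [yA3 wB3 dAB3 S3 AB3] dAB.
(* The boundary of the corner [B1 :&: A3], as no vertex is in [A1 :&: B3]. *)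
pose N := ~: (A1 :|: B3) :\: (B1 :&: A3).
have N1 : #|N| <= 1.
  have c : #|N| + #|B3| + #|B1 :&: A3| = #|~: (A1 :|: B1)| + #|B1|
    by exact: card_uncross_eq.
  have : 0 < #|B1 :&: A3| by apply/card_gt0P; exists y; rewrite inE yB1.
  by move: c S1 B13; clear; lia.
move: (C4 _ yC); apply/negP; rewrite -leqNgt.
apply: (@corner_deg (B1 :&: A3) N x w y x).
- by rewrite inE yB1.
- by rewrite inE (disjointFr dAB1 xA1).
- by rewrite in_setD !in_setC !in_setU xA1 andbF.
- by rewrite disjoint_sym disjoints_subset subsetDr.
- by [].
- move=> u v /setIP[uB1 uA3] vX uv; rewrite in_setD vX in_setC in_setU.
  have [vA1|_] := boolP (v \in A1).
    by rewrite adj_sym in uv; have [-> ->] := AB1 _ _ vA1 uB1 uv; auto.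
  have [vB3|_] := boolP (v \in B3); last by left.
  by have [-> ->] := AB3 _ _ uA3 vB3 uv; auto.
Qed.

Lemma forest_arcs C : C != set0 ->
  {in C, forall x, 4 <= #|nb x|} -> arcs C C + 2 <= 2 * #|C|.
Proof.
have [m] := ubnP #|C|; elim: m C => // m IH C Cm C0 C4.
have [x xC d1] := no_cycle_deg_ge4 C0 C4.
have sC : [set x] \subset C by rewrite sub1set.
have e : arcs C C <= arcs (C :\ x) (C :\ x) + 2.
  rewrite (arcsDl C sC) (arcsDr (C :\ x) sC).
  have -> : arcs [set x] C = #|nb x :&: C| by rewrite arcs_nb big_set1.
  suff: arcs (C :\ x) [set x] <= #|nb x :&: C| by lia.
  have -> : #|nb x :&: C| = arcs [set x] C by rewrite arcs_nb big_set1.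
  by rewrite arcsC arcsS // subsetDl.
have cC := cardsD1 x C; rewrite xC in cC.
have [E|nE] := eqVneq (C :\ x) set0.
  have sub : C \subset [set x] by rewrite -setD_eq0 E.
  have := arcsS sub sub; rewrite [X in _ <= X]arcs_nb big_set1 cC E cards0.
  have -> : nb x :&: [set x] = set0; last by rewrite cards0; lia.
  by apply/setP => v; rewrite in_setI in_set1 in_set0; case: eqP => [->|_]; rewrite ?nb_irr ?andbF.
have: arcs (C :\ x) (C :\ x) + 2 <= 2 * #|C :\ x|.
  apply: IH => //; first by lia.
  by move=> v /setD1P[_ vC]; exact: C4.
lia.
Qed.

(** * Counting edges over the vertices of degree 3 *)

Definition big : {set G} := [set x | 4 <= #|nb x|].
Definition small : {set G} := ~: big.

Lemma bigE x : (x \in big) = (4 <= #|nb x|).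
Proof. by rewrite inE. Qed.

Lemma smallE x : (x \in small) = (x \notin big).
Proof. by rewrite in_setC. Qed.

Lemma deg_small x : x \in small -> #|nb x| = 3.
Proof.
by rewrite smallE bigE -leqNgt => d3; apply/eqP; rewrite eqn_leq d3 deg_ge3.
Qed.

Lemma card_small : #|small| + #|big| = #|G|.
Proof. by rewrite addnC cardsC. Qed.

Lemma arcs_small Y : arcs small Y + arcs small (~: Y) = 3 * #|small|.
Proof.
rewrite -(setTD Y) -(arcsDr small (subsetT Y)) arcs_nb mulnC -sum_nat_const.
by apply: eq_bigr => x xT; rewrite setIT deg_small.
Qed.

Lemma edge_count : 2 * #|edges G| + arcs small small = 6 * #|small| + arcs big big.
Proof.
rewrite handshake (arcsDl _ (subsetT small)) (arcsDr small (subsetT big)).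
rewrite (arcsDr _ (subsetT big)) !setTD /small setCK -/small.
have := arcs_small big; rewrite -/small (arcsC big small).
by clear; lia.
Qed.

Lemma forest_big : arcs big big <= 2 * #|big| - 2.
Proof.
have [E|nE] := eqVneq big set0.
  by rewrite E arcs_nb big_set0.
have := @forest_arcs big nE (fun x => _); suff H : {in big, forall x, 3 < #|nb x|}.
  by move/(_ H); clear; lia.
by move=> x; rewrite bigE.
Qed.

(** Unions of components of the subgraph on the vertices of degree 3. *)
Definition closed X :=
  X \subset small /\ forall u v, u \in X -> v \notin X -> adj u v -> v \in big.

Lemma closed_small : closed small.
Proof. by split=> // u v _; rewrite smallE negbK. Qed.

Lemma closedI X Y : closed X -> closed Y -> closed (X :&: Y).
Proof.
case=> sX cX [_ cY]; split; first exact: subset_trans (subsetIl _ _) sX.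
move=> u v /setIP[uX uY]; rewrite in_setI negb_and => /orP[vX|vY].
  exact: cX uX vX.
exact: cY uY vY.
Qed.

Lemma closedD X Y : closed X -> closed Y -> closed (X :\: Y).
Proof.
case=> sX cX [_ cY]; split; first exact: subset_trans (subsetDl _ _) sX.
move=> u v /setDP[uX uY]; rewrite in_setD negb_and negbK => /orP[vY|vX].
  rewrite adj_sym => vu; have := cY _ _ vY uY vu.
  by have := subsetP sX _ uX; rewrite smallE => /negP.
exact: cX uX vX.
Qed.

(** The big vertices adjacent to a closed set [X] separate it from any other
    big vertex [b]. *)
Lemma closed_attach X N b : closed X -> X != set0 -> N \subset big ->
  b \in big -> b \notin N ->
  (forall u v, u \in X -> v \in big -> adj u v -> v \in N) -> 3 <= #|N|.
Proof.
case=> sX cX X0 sN bF bN XN; apply: (@cut_ge3 X N b) => //.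
- by apply/negP => /(subsetP sX); rewrite smallE bF.
- by move=> u v uX vX uv; apply: (XN u v uX _ uv); exact: (cX u v).
- rewrite disjoints_subset; apply/subsetP => u /(subsetP sX).
  by rewrite smallE in_setC; apply: contra => /(subsetP sN).
Qed.

(** A largest set [Y] around [r] with [#|Y| - 1] edges, that is, grown along
    a tree, is closed: an edge leaving it inside [X] would extend it. *)
Lemma closed_part X r : closed X -> r \in X ->
  exists Y, [/\ closed Y, Y \subset X, r \in Y & 2 * #|Y| <= arcs Y Y + 2].
Proof.
move=> [sX cX] rX.
pose P Y := [&& Y \subset X, r \in Y & 2 * #|Y| <= arcs Y Y + 2].
have P0 : P [set r] by rewrite /P sub1set rX inE eqxx cards1 addnC.
case: (arg_maxnP (fun Y : {set G} => #|Y|) P0) => Y /and3P[YX rY dY] maxY.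
exists Y; split=> //; split; first exact: subset_trans YX sX.
move=> u v uY vY uv; apply: contraT; rewrite -smallE => vT.
have vX : v \in X.
  apply: contraT => vX; have := cX _ _ (subsetP YX _ uY) vX uv.
  by move: vT; rewrite smallE => /negP.
have cv : #|v |: Y| = #|Y|.+1 by rewrite cardsU1 vY.
suff /maxY : P (v |: Y) by rewrite /= cv ltnn.
rewrite /P subUset sub1set vX YX in_setU1 rY orbT cv /=.
have sub : Y \subset v |: Y by exact: subsetUr.
rewrite (arcsDl _ sub) (arcsDr Y sub).
have vD : v \in (v |: Y) :\: Y by rewrite in_setD vY in_setU1 eqxx.
have : 0 < arcs Y ((v |: Y) :\: Y) by apply/arcs_gt0P; exists u, v.
have : 0 < arcs ((v |: Y) :\: Y) (v |: Y).
  by apply/arcs_gt0P; exists v, u; rewrite in_setU1 uY orbT adj_sym.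
by move: dY; clear; lia.
Qed.

(** A small vertex has at most [#|big|] big neighbours, hence at least
    [3 - #|big|] small ones. *)
Lemma edges_big_le1 : 4 <= #|G| -> #|big| <= 1 -> #|edges G| <= 2 * #|G| - 2.
Proof.
move=> n4 f1.
have := edge_count; have := arcs_small small; rewrite /small setCK -/small.
have : arcs small big <= #|small| * #|big|.
  rewrite arcs_nb -sum_nat_const leq_sum // => x _.
  by apply/subset_leq_card/subsetIr.
have := forest_big; have := card_small.
move: f1 n4; clear; case: #|big| => [|[|//]] _; rewrite ?muln0 ?muln1; lia.
Qed.

(** The small vertices are connected, since two big vertices do not separate
    the graph, so they span at least [#|small| - 1] edges. *)
Lemma edges_big_2 : 4 <= #|G| -> #|big| = 2 -> #|edges G| <= 2 * #|G| - 2.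
Proof.
move=> n4 f2; have c := card_small; have ec := edge_count; have fo := forest_big.
have /card_gt0P[r rT] : 0 < #|small| by move: n4 f2 c; clear; lia.
have [Y [cY YT rY dY]] := closed_part closed_small rT.
have /card_gt0P[a aF] : 0 < #|big| by rewrite f2.
have [E|nE] := eqVneq (small :\: Y) set0.
  have YE : Y = small by apply/eqP; rewrite eqEsubset YT -setD_eq0 E eqxx.
  by move: dY c ec fo; rewrite YE f2; clear; lia.
have: 3 <= #|big|; last by rewrite f2.
have nY : Y != set0 by apply/set0Pn; exists r.
have /set0Pn[z zD] := nE.
apply: (@cut_ge3 Y big z) => //.
- by move: zD => /setDP[].
- by rewrite -smallE; move: zD => /setDP[].
- by case: cY.
- by rewrite disjoints_subset.
Qed.

(** The part in [A] of a closed set that avoids the separator of the split of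
    [ab] is closed again, and attached only to big vertices outside [B]. *)
Lemma closed_side a b A B Y : edge_split a b A B -> a \in big -> b \in big ->
  closed Y -> Y \subset A :|: B ->
  closed (Y :&: A) /\ (Y :&: A != set0 -> 3 <= #|big :\: B|).
Proof.
case=> aA bB dAB _ AB aF bF [sY cY] sub.
have cYA : closed (Y :&: A).
  split; first exact: subset_trans (subsetIl _ _) sY.
  move=> u v /setIP[uY uA]; rewrite in_setI negb_and => /orP[vY|vA] uv.
    exact: cY uv.
  have [vY|vY] := boolP (v \in Y); last exact: cY uv.
  have := subsetP sub _ vY; rewrite in_setU (negbTE vA) /= => vB.
  by have [_ ->] := AB _ _ uA vB uv.
split=> // YA0; apply: (closed_attach (b := b) cYA) => //; first exact: subsetDl.
  by rewrite in_setD bB.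
move=> u v /setIP[uY uA] vF uv; rewrite in_setD vF andbT; apply/negP => vB.
have [ua _] := AB _ _ uA vB uv.
by have := subsetP sY _ uY; rewrite smallE ua aF.
Qed.

(** Let [ab] be an edge between two of the three big vertices.  By
    [closed_side], a closed set that avoids the separator of its split would
    be attached to at most two big vertices.  So each of the disjoint closed
    sets of small vertices uses up a vertex of the separator, hence there are
    at most two components, which span at least [#|small| - 2] edges. *)
Lemma edges_big_3 : #|big| = 3 -> 0 < arcs big big -> #|edges G| <= 2 * #|G| - 2.
Proof.
move=> f3 /arcs_gt0P[a [b [aF bF ab]]].
have [A [B sp]] := edge_split_exists crit ab.
have meets Y : closed Y -> Y != set0 -> exists2 s, s \in Y & s \in ~: (A :|: B).
  move=> cY Y0; have [sub|/subsetPn[s sY nS]] := boolP (Y \subset A :|: B); last first.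
    by exists s; rewrite ?in_setC.
  have D1 c (C : {set G}) : c \in big -> c \in C -> ~ 3 <= #|big :\: C|.
    move=> cF cC le3; have : #|big :\: C| <= #|big :\ c|.
      apply/subset_leq_card/subsetP => v; rewrite !in_setD in_set1.
      by move=> /andP[vC ->]; rewrite andbT; apply: contraNneq vC => ->.
    by have := cardsD1 c big; rewrite cF f3; move: le3; clear; lia.
  have [_ H1] := closed_side sp aF bF cY sub.
  rewrite setUC in sub.
  have [_ H2] := closed_side (edge_splitC sp) bF aF cY sub.
  case: sp => aA bB _ _ _; move: Y0 sub => /set0Pn[y yY] /subsetP/(_ y yY).
  case/setUP => yB.
    case: (D1 a A aF aA); apply: H2; apply/set0Pn; exists y; by rewrite inE yY.
  case: (D1 b B bF bB); apply: H1; apply/set0Pn; exists y; by rewrite inE yY.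
have ec := edge_count; have fo := forest_big; have c := card_small.
have [E|/set0Pn[r rT]] := eqVneq small set0.
  by move: ec fo c; rewrite f3 E cards0; clear; lia.
have [Y [cY sY rY dY]] := closed_part closed_small rT.
have cD := closedD closed_small cY.
have cS : #|small| = #|Y| + #|small :\: Y| by rewrite -[LHS](cardsID Y) (setIidPr sY).
have [E|/set0Pn[q qD]] := eqVneq (small :\: Y) set0.
  have YE : Y = small by apply/eqP; rewrite eqEsubset sY -setD_eq0 E eqxx.
  by move: dY c ec fo; rewrite YE f3; clear; lia.
have [Z [cZ sZ qZ dZ]] := closed_part cD qD.
have cW := closedD cD cZ.
have cSZ : #|small :\: Y| = #|Z| + #|small :\: Y :\: Z|.
  by rewrite -[LHS](cardsID Z) (setIidPr sZ).
have dYZ : [disjoint Y & Z].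
  by rewrite disjoint_sym; move: sZ; rewrite subsetD => /andP[].
have [E|W0] := eqVneq (small :\: Y :\: Z) set0.
  have sZT : Z \subset small by exact: subset_trans sZ (subsetDl _ _).
  have := arcs_subadd dYZ sY sZT.
  by move: dY dZ cS cSZ c ec fo; rewrite E cards0 f3; clear; lia.
have [s1 s1Y s1S] := meets Y cY (introT (set0Pn _) (ex_intro _ r rY)).
have [s2 s2Z s2S] := meets Z cZ (introT (set0Pn _) (ex_intro _ q qZ)).
have [s3 s3W s3S] := meets _ cW W0.
case: sp => _ _ _ S2 _; have: 3 <= #|~: (A :|: B)|; last by rewrite leqNgt ltnS S2.
have /card_uniqP /= sz3 : uniq [:: s1; s2; s3].
  move: s3W; rewrite !in_setD => /and3P[s3Z s3Y _].
  rewrite /= in_cons !mem_seq1 negb_or andbT -andbA; apply/and3P; split=> //.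
  - by apply: contraTneq s2Z => <-; rewrite (disjointFr dYZ).
  - by apply: contraNneq s3Y => <-.
  - by apply: contraNneq s3Z => <-.
rewrite -sz3; apply/subset_leq_card/subsetP => s.
by rewrite inE [s \in [:: s2; s3]]inE mem_seq1 => /or3P[]/eqP->.
Qed.

(** * Four vertices of degree at least 4 *)

(** The separator of the split of [pq] contains all common neighbours. *)
Lemma adj_common_le2 p q : adj p q -> #|nb p :&: nb q| <= 2.
Proof.
move=> pq; have [A [B [pA qB dAB S2 AB]]] := edge_split_exists crit pq.
apply: leq_trans S2; apply/subset_leq_card/subsetP => x; rewrite !inE.
move=> /andP[px qx]; apply/norP; split; apply/negP => xC.
  have xq : adj x q by rewrite adj_sym.
  by have [e _] := AB _ _ xC qB xq; rewrite e adj_irrefl in px.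
by have [_ e] := AB _ _ pA xC px; rewrite e adj_irrefl in qx.
Qed.

(** The components of one vertex of the subgraph on the small vertices. *)
Definition lone : {set G} :=
  [set x in small | [forall y in small, ~~ adj x y]].

Lemma loneP x y : x \in lone -> adj x y -> y \in big.
Proof.
rewrite inE => /andP[_ /forallP/(_ y)]; rewrite smallE implybE negbK.
by case/orP=> // /negP.
Qed.

Lemma lone_small x : x \in lone -> x \in small.
Proof. by rewrite inE => /andP[]. Qed.

Lemma closed_lone X : X \subset lone -> closed X.
Proof.
move=> sX; split=> [|u v /(subsetP sX) uL _]; last exact: loneP uL.
by apply/subsetP => u /(subsetP sX)/lone_small.
Qed.

Section FourBig.
Hypotheses (big4 : #|big| = 4) (lone3 : 3 <= #|lone|).
(* Either all small vertices are lone, or they span one edge and the four big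
   vertices span a tree; 6 is the number of arcs of a tree with 3 edges. *)
Hypothesis small_edge : forall u v, u \in small -> v \in small -> adj u v ->
  arcs big big = 6 /\ {in small :\: lone, forall x, x = u \/ x = v}.

(** Suppose that no component lies inside [A].  The lone vertices outside the
    separator [S] are then in [B], and by [closed_side] they attach [B] to
    three big vertices outside [A], so that [a] is the only big vertex of [A].
    As [a] has degree at least 4, a small vertex [u] lies in [A]; it is not
    lone, so it has a small neighbour [v], which must be in [S].  The degree of
    [u] puts all of [S] among its neighbours, so that no lone vertex is in [S];
    all of them are in [B] and adjacent to the three big vertices other than
    [a].  Having three common neighbours, these are pairwise nonadjacent, and
    [a] has at most two big neighbours, [b] and the one in [S]: fewer than the
    three edges of the tree. *)
Lemma side_nonempty a b A B : edge_split a b A B -> a \in big -> b \in big ->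
  exists Y, [/\ closed Y, Y != set0 & Y \subset A].
Proof.
move=> sp aF bF; have [aA bB dAB S2 AB] := sp; set S := ~: (A :|: B) in S2.
have [/existsP[x]|noA] := boolP [exists x, x \in lone :&: A].
  rewrite inE => /andP[xL xA]; exists [set x]; rewrite sub1set xA; split=> //.
    by apply: closed_lone; rewrite sub1set.
  by apply/set0Pn; exists x; rewrite inE.
have loneA x : x \in lone -> x \notin A.
  by move=> xL; apply: contraNN noA => xA; apply/existsP; exists x; rewrite inE xL.
have inS x : (x \in S) = (x \notin A) && (x \notin B) by rewrite in_setC in_setU negb_or.
have [x xL xB] : exists2 x, x \in lone & x \in B.
  have /subsetPn[x xL xS] : ~~ (lone \subset S).
    by apply: contraL lone3 => /subset_leq_card le; rewrite -leqNgt (leq_trans le).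
  by exists x => //; move: xS; rewrite inS (loneA _ xL) /= negbK.
have FA1 : big :&: A = [set a].
  have cx : closed [set x] by apply: closed_lone; rewrite sub1set.
  have sx : [set x] \subset B :|: A by rewrite sub1set in_setU xB.
  have [_ H] := closed_side (edge_splitC sp) bF aF cx sx.
  have : 3 <= #|big :\: A|.
    by apply: H; apply/set0Pn; exists x; rewrite !inE eqxx.
  have := cardsID A big; rewrite big4 => e le3.
  apply/eqP; rewrite eq_sym eqEcard sub1set inE aF aA cards1.
  by move: e le3; clear; lia.
have [u uT uA] : exists2 u, u \in small & u \in A.
  have : 0 < #|nb a :\: (b |: S)|.
    have := cardsID (b |: S) (nb a); have := cardsU1 b S.
    have : #|nb a :&: (b |: S)| <= #|b |: S| by apply/subset_leq_card/subsetIr.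
    by move: aF S2; rewrite bigE; clear; case: (b \notin S); lia.
  case/card_gt0P => u; rewrite in_setD in_setU1 negb_or inS => /andP[/andP[ub uS]].
  rewrite inE => au; have uA : u \in A.
    apply: contraR uS => uA; rewrite uA; apply/negP => uB.
    by have [_ e] := AB _ _ aA uB au; rewrite e eqxx in ub.
  exists u => //; rewrite smallE; apply/negP => uF.
  have : u \in big :&: A by rewrite inE uF.
  by rewrite FA1 inE => /eqP e; rewrite e adj_irrefl in au.
have ua : u != a by apply: contraTneq uT => ->; rewrite smallE aF.
have [v vT uv] : exists2 v, v \in small & adj u v.
  have : u \notin lone by apply: contraL uA => /loneA.
  rewrite inE uT /= negb_forall => /existsP[v]; rewrite negb_imply negbK.
  by case/andP; exists v.
have [ff6 uvT] := small_edge uT vT uv.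
have uLo : u \notin lone by apply: contraL uA => /loneA.
have vLo : v \notin lone.
  apply/negP => vL; have vu : adj v u by rewrite adj_sym.
  by have := loneP vL vu; apply/negP; rewrite -smallE.
have [vA|vA] := boolP (v \in A).
  exists [set u; v]; split; last by rewrite subUset !sub1set uA.
  - split; first by rewrite subUset !sub1set uT.
    move=> p q pD qD pq; apply: contraNT qD; rewrite -smallE => qT.
    have qL : q \notin lone.
      apply/negP => qL; have qp : adj q p by rewrite adj_sym.
      have := loneP qL qp; apply/negP; rewrite -smallE.
      by move: pD; rewrite in_set2 => /orP[]/eqP->.
    by case: (uvT q) => [|->|->]; rewrite ?in_setD ?qL // !inE eqxx ?orbT.
  - by apply/set0Pn; exists u; rewrite !inE eqxx.
exfalso.
have nuB w : adj u w -> w \notin B.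
  move=> uw; apply/negP => wB; have [e _] := AB _ _ uA wB uw.
  by rewrite e eqxx in ua.
have vS : v \in S by rewrite inS vA nuB.
have AE w : w \in A -> w = a \/ w = u.
  move=> wA; have [wF|wT] := boolP (w \in big).
    by left; apply/eqP; rewrite -in_set1 -FA1 inE wF.
  case: (uvT w) => [|->|e]; auto; last by rewrite -e wA in vA.
  by rewrite in_setD smallE wT andbT; apply: contraL wA => /loneA.
have nbu : nb u = a |: S.
  apply/eqP; rewrite eqEcard; apply/andP; split.
    apply/subsetP => w; rewrite inE => uw; rewrite in_setU1 inS nuB // andbT.
    case: (boolP (w \in A)) => [/AE[->|e]|_]; rewrite ?eqxx ?orbT //.
    by rewrite e adj_irrefl in uw.
  rewrite (deg_small uT) cardsU1; move: S2; clear.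
  by case: (a \notin S); lia.
have adjS w : w \in S -> adj u w.
  by move=> wS; have: w \in nb u; [rewrite nbu in_setU1 wS orbT | rewrite inE].
have loneB w : w \in lone -> w \in B.
  move=> wL; apply: contraT => wB; have wS : w \in S by rewrite inS loneA.
  have := loneP wL (_ : adj w u); rewrite adj_sym adjS // => /(_ isT).
  by move: uT; rewrite smallE => /negP.
have nb_lone w : w \in lone -> nb w = big :\ a.
  move=> wL; apply/eqP; rewrite eqEcard; apply/andP; split.
    apply/subsetP => z; rewrite inE => wz; rewrite in_setD1 (loneP wL wz) andbT.
    apply: contraTneq wz => ->; rewrite adj_sym; apply/negP => aw.
    have [_ e] := AB _ _ aA (loneB _ wL) aw.
    by move: (lone_small wL); rewrite smallE e bF.
  rewrite (deg_small (lone_small wL)); have := cardsD1 a big.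
  by rewrite aF big4; clear; lia.
have indep : arcs (big :\ a) (big :\ a) = 0.
  apply/eqP; rewrite -leqn0 leqNgt; apply/negP => /arcs_gt0P[p [q [pF qF pq]]].
  have := adj_common_le2 pq; rewrite leqNgt => /negP; apply.
  apply: leq_trans lone3 _; apply/subset_leq_card/subsetP => w wL.
  by rewrite inE !(nbC _ w) (nb_lone _ wL) pF qF.
have sa : [set a] \subset big by rewrite sub1set.
have dega : arcs [set a] big <= 2.
  rewrite arcs_nb big_set1.
  have sub : nb a :&: big \subset b |: (S :\ v).
    apply/subsetP => w; rewrite in_setI inE => /andP[aw wF].
    rewrite in_setU1 in_setD1 inS.
    have -> : w \notin A.
      apply: contraL aw => wA; have : w \in big :&: A by rewrite inE wF.
      by rewrite FA1 inE => /eqP ->; rewrite adj_irrefl.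
    have -> /= : w != v by apply: contraTneq wF => ->; rewrite -smallE.
    by case: (boolP (w \in B)) => [/AB-/(_ _ aA aw)[_ ->]|_]; rewrite ?eqxx ?orbT.
  apply: leq_trans (subset_leq_card sub) _; rewrite cardsU1.
  have := cardsD1 v S; rewrite vS; move: S2; clear.
  by case: (b \notin _); lia.
have := arcsDl big sa; rewrite (arcsDr (big :\ a) sa) indep ff6 (arcsC (big :\ a)) => e.
have le : arcs [set a] (big :\ a) <= arcs [set a] big by rewrite arcsS ?subsetDl.
by move: dega le e; clear; lia.
Qed.

(** As both sides contain components, each side leaves at least three big
    vertices to the other side and the separator.  Of the four, two are
    then in the separator, which has no room for small vertices. *)
Lemma split_closed a b : a \in big -> b \in big -> adj a b ->
  exists P Q, [/\ closed P /\ closed Q, P != set0 /\ Q != set0, small = P :|: Q,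
    {in P, forall u, ~~ adj u b} & {in Q, forall u, ~~ adj u a}].
Proof.
move=> aF bF ab; have [A [B sp]] := edge_split_exists crit ab.
have [P [cP P0 sP]] := side_nonempty sp aF bF.
have [Q [cQ Q0 sQ]] := side_nonempty (edge_splitC sp) bF aF.
have [aA bB dAB S2 AB] := sp.
have [_] := closed_side sp aF bF cP (subset_trans sP (subsetUl _ _)).
rewrite (setIidPl sP) => /(_ P0) FB.
have [_] := closed_side (edge_splitC sp) bF aF cQ (subset_trans sQ (subsetUl _ _)).
rewrite (setIidPl sQ) => /(_ Q0) FA.
have SF : ~: (A :|: B) \subset big.
  have e : #|big| + #|big :\: (A :|: B)| = #|big :\: A| + #|big :\: B|.
    rewrite !card_indicator -!big_split; apply: eq_bigr => v _; rewrite !inE.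
    by have := disjointIF v dAB; do 2!case: (v \in _); case: leqP.
  have sub : big :\: (A :|: B) \subset ~: (A :|: B).
    by apply/subsetP => v /setDP[_]; rewrite in_setC.
  have /eqP <- : big :\: (A :|: B) == ~: (A :|: B); last exact: subsetDl.
  by rewrite eqEcard sub; move: e FA FB S2; rewrite big4; clear; lia.
have TE x : x \in small -> (x \in A) || (x \in B).
  rewrite smallE; apply: contraNT; rewrite -in_setU -in_setC; exact: (subsetP SF).
have sT : small \subset A :|: B by apply/subsetP => x /TE; rewrite inE.
have [cA _] := closed_side sp aF bF closed_small sT.
rewrite setUC in sT.
have [cB _] := closed_side (edge_splitC sp) bF aF closed_small sT.
have sub0 X Y C : X != set0 -> closed X -> X \subset C -> small :&: C != set0.
  move=> /set0Pn[x xX] [sX _] sC; apply/set0Pn; exists x.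
  by rewrite inE (subsetP sX) ?(subsetP sC).
exists (small :&: A), (small :&: B); split=> //.
- by split; [exact: (sub0 P P) | exact: (sub0 Q Q)].
- by rewrite -setIUr setUC (setIidPl sT).
- move=> u /setIP[uT uA]; apply/negP => ub; have [e _] := AB _ _ uA bB ub.
  by rewrite smallE e aF in uT.
- move=> u /setIP[uT uB]; apply/negP; rewrite adj_sym => au.
  by have [_ e] := AB _ _ aA uB au; rewrite smallE e bF in uT.
Qed.

(** Two edges between big vertices: let [b] be an end of the first that is
    not an end of the second, [xy].  By [split_closed] for the first edge some
    component misses [b], and by [split_closed] for the second it misses [x]
    or [y].  It is then attached to two big vertices only. *)
Lemma four_big_arcs : arcs big big <= 2.
Proof.
have key a b x y : a \in big -> b \in big -> x \in big -> y \in big ->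
    adj a b -> adj x y -> b != x -> b != y -> False.
  move=> aF bF xF yF ab xy bx by_.
  have [P [_ [[cP _] [P0 _] _ Pb _]]] := split_closed aF bF ab.
  have [Q [R [[cQ cR] _ TE Qy Rx]]] := split_closed xF yF xy.
  have gone Z c : closed Z -> c \in big -> b != c -> {in Z, forall u, ~~ adj u c} ->
      P :&: Z = set0.
    move=> cZ cF bc Zc; apply/eqP/negPn/negP => Z0.
    have: 3 <= #|big :\ b :\ c|.
      apply: (closed_attach (b := b) (closedI cP cZ) Z0) => //.
      - by apply: subset_trans (subsetDl _ _) (subsetDl _ _).
      - by rewrite !inE eqxx andbF.
      - move=> u v /setIP[uP uZ] vF uv; rewrite !in_setD1 vF andbT.
        by apply/andP; split; apply: contraTneq uv => ->; rewrite ?Zc ?Pb.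
    have := cardsD1 b big; have := cardsD1 c (big :\ b).
    by rewrite in_setD1 cF bF big4 eq_sym bc; clear; lia.
  have /set0Pn[u uP] := P0.
  have : u \in Q :|: R by rewrite -TE; case: cP => sP _; exact: (subsetP sP).
  case/setUP => uZ.
    by move/setP/(_ u): (gone Q y cQ yF by_ Qy); rewrite !inE uP uZ.
  by move/setP/(_ u): (gone R x cR xF bx Rx); rewrite !inE uP uZ.
rewrite leqNgt; apply/negP => ff.
have /arcs_gt0P[a [b [aF bF ab]]] : 0 < arcs big big by exact: leq_trans ff.
have /subsetPn[[x y]] : ~~ (arc_set big big \subset [set (a, b); (b, a)]).
  apply: contraL ff => /subset_leq_card le; rewrite -leqNgt.
  by apply: leq_trans le _; rewrite cards2; case: (_ != _).
rewrite !inE /= !xpair_eqE => /andP[/andP[xF yF] xy]; rewrite -!bigE in xF yF.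
move/norP=> [n1 n2].
have nxy : x != y by apply: contraTneq xy => ->; rewrite adj_irrefl.
have ba : adj b a by rewrite adj_sym.
have [ebx|bx] := eqVneq b x.
  subst x; apply: (key b a b y) => //.
    by apply: contraTneq ab => ->; rewrite adj_irrefl.
  by apply: contraNneq n2 => ->; rewrite !eqxx.
have [eby|by_] := eqVneq b y; last exact: (key a b x y).
subst y; apply: (key b a x b) => //.
  by apply: contraNneq n1 => ->; rewrite !eqxx.
by apply: contraTneq ab => ->; rewrite adj_irrefl.
Qed.

End FourBig.

(** * The extremal structures *)

Lemma arcs2_edge X : 0 < arcs X X -> arcs X X <= 2 ->
  exists u v, [/\ u \in X, v \in X, adj u v &
    forall x y, x \in X -> y \in X -> adj x y -> x = u /\ y = v \/ x = v /\ y = u].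
Proof.
move=> /arcs_gt0P[u [v [uX vX uv]]] le2; exists u, v; split=> // x y xX yX xy.
have nuv : u != v by apply: contraTneq uv => ->; rewrite adj_irrefl.
have [[-> ->]|n1] := (x, y) =P (u, v); first by left.
have [[-> ->]|n2] := (x, y) =P (v, u); first by right.
suff: 3 <= arcs X X by rewrite leqNgt ltnS le2.
apply: (@size_arcs G [:: (u, v); (v, u); (x, y)]).
  rewrite /= !inE /= negb_or andbT; apply/andP; split; last first.
    by apply/eqP => e; case: n2.
  apply/andP; split; first by rewrite xpair_eqE negb_and nuv.
  by apply/eqP => e; case: n1.
by move=> q; rewrite !inE => /or3P[]/eqP-> /=; rewrite ?uX ?vX // adj_sym.
Qed.

Lemma arcs_neq1 X : arcs X X != 1.
Proof.
apply/eqP => a1; have [||u [v [uX vX uv _]]] := @arcs2_edge X; rewrite ?a1 //.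
suff: 2 <= arcs X X by rewrite a1.
apply: (@size_arcs G [:: (u, v); (v, u)]).
  rewrite /= inE andbT xpair_eqE negb_and.
  by rewrite (_ : u != v) //; apply: contraTneq uv => ->; rewrite adj_irrefl.
by move=> q; rewrite !inE => /orP[]/eqP-> /=; rewrite ?uX ?vX // adj_sym.
Qed.

(** If the bound failed, parity and the forest bound would leave only the
    cases that [four_big_arcs] excludes: no small edge and at least two big
    edges, or one small edge and three big edges. *)
Lemma edges_big_4 : #|big| = 4 -> 7 <= #|G| ->
  #|edges G| + minn 11 (#|G| + 2) <= 3 * #|G|.
Proof.
move=> f4 n7; have ec := edge_count; have c := card_small; have fo := forest_big.
rewrite leqNgt; apply/negP => bad.
have [n8 [ff4 tt]] : 8 <= #|G| /\ 4 <= arcs big big /\ (arcs small small = 0 \/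
    9 <= #|G| /\ arcs small small = 2 /\ arcs big big = 6).
  have := arcs_neq1 small; move: ec c fo bad n7; rewrite f4; clear.
  by case: (leqP 11 (_ + 2)); lia.
have: arcs big big <= 2; last by move: ff4; clear; lia.
case: tt => [t0|[n9 [t2 ff6]]].
  have loneE : lone = small.
    apply/setP => x; rewrite [LHS]inE; apply: andb_idr => xT.
    by apply/forallP => y; apply/implyP => yT; rewrite (arcs_eq0 t0).
  apply: four_big_arcs => //.
    by rewrite loneE; move: c n8; rewrite f4; clear; lia.
  by move=> u v uT vT; rewrite (arcs_eq0 t0).
have [||u [v [uT vT uv uniq_uv]]] := @arcs2_edge small; rewrite ?t2 //.
have rest x : x \in small :\: lone -> x = u \/ x = v.
  move=> /setDP[xT]; rewrite inE xT /= negb_forall => /existsP[y].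
  rewrite negb_imply negbK => /andP[yT xy].
  by case: (uniq_uv x y) => // -[-> _]; auto.
apply: four_big_arcs => //.
  have sub : small \subset u |: (v |: lone).
    apply/subsetP => x xT; rewrite !in_setU1; have [|xL] := boolP (x \in lone).
      by rewrite !orbT.
    by case: (rest x) => [|->|->]; rewrite ?eqxx ?orbT // in_setD xL.
  have := subset_leq_card sub; rewrite !cardsU1; move: c n9; rewrite f4; clear.
  by case: (u \notin _); case: (v \notin _); lia.
move=> x y xT yT xy; split=> // z zD.
by case: (uniq_uv x y xT yT xy) (rest z zD) => -[-> ->] [->|->]; auto.
Qed.

(** [minn 11 (n + 2)] expresses at once the bounds [3n - 11] and [2n - 2],
    which cross at [n = 9]. *)
Lemma edges_shape : 7 <= #|G| ->
  (#|big| = 3 /\ arcs big big = 0) \/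
  #|edges G| + minn 11 (#|G| + 2) <= 3 * #|G|.
Proof.
move=> n7; have n4 : 4 <= #|G| by exact: leq_trans n7.
have sparse : #|edges G| <= 2 * #|G| - 2 ->
    #|edges G| + minn 11 (#|G| + 2) <= 3 * #|G|.
  by move: n7; clear; case: (leqP 11 (_ + 2)); lia.
case: (ltngtP #|big| 4) => [f3|f5|f4]; last by right; exact: edges_big_4.
  case: (ltngtP #|big| 2) => [f1|f3'|f2]; last 1 first.
  - by right; apply: sparse; exact: edges_big_2.
  - by right; apply: sparse; apply: edges_big_le1.
  - have e3 : #|big| = 3 by apply/eqP; rewrite eqn_leq f3' -ltnS f3.
    have [ff0|ff] := posnP (arcs big big); first by left.
    by right; apply: sparse; exact: edges_big_3.
right; have := edge_count; have := card_small; have := forest_big.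
by move: f5 n7; clear; case: (leqP 11 (_ + 2)); lia.
Qed.

Lemma iso_of_embedding (H : sgraph) (g : H -> G) : injective g -> #|G| <= #|H| ->
  (forall x y : H, adj (g x) (g y) = adj x y) -> isomorphic G H.
Proof.
move=> inj_g le gA; have [f fK gK] := inj_card_bij inj_g le.
exists f; split; first by exists g.
by move=> x y; rewrite -gA !gK.
Qed.

Section ThreeBig.
Hypotheses (big3 : #|big| = 3) (big_indep : arcs big big = 0).

Lemma iso_biclique : arcs small small = 0 ->
  isomorphic G (biclique 3 (#|G| - 3)).
Proof.
move=> t0; have sz : #|small| = #|G| - 3.
  by have := card_small; rewrite big3; clear; lia.
pose g (x : biclique 3 (#|G| - 3)) : G := match x with
  | inl i => enum_val (cast_ord (esym big3) i)
  | inr j => enum_val (cast_ord (esym sz) j) end.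
have gl i : g (inl i) \in big by exact: enum_valP.
have gr j : g (inr j) \in small by exact: enum_valP.
have sb x y : x \in small -> y \in big -> adj x y.
  move=> xT yF; have : nb x = big.
    apply/eqP; rewrite eqEcard big3 deg_small // leqnn andbT.
    apply/subsetP => z; rewrite inE; apply: contraLR; rewrite -smallE => zT.
    by rewrite (arcs_eq0 t0).
  by move/setP/(_ y); rewrite yF inE.
apply: (@iso_of_embedding _ g) => [[i|j] [i'|j']|| [i|j] [i'|j']].
- by move/enum_val_inj/cast_ord_inj->.
- by move=> e; have := gr j'; rewrite -e smallE gl.
- by move=> e; have := gr j; rewrite e smallE gl.
- by move/enum_val_inj/cast_ord_inj->.
- have -> : #|biclique 3 (#|G| - 3)| = 3 + (#|G| - 3) by rewrite card_sum !card_ord.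
  by clear; lia.
- by rewrite (arcs_eq0 big_indep).
- by rewrite adj_sym sb.
- by rewrite sb.
- by rewrite (arcs_eq0 t0).
Qed.

(** A small vertex with exactly one small neighbour has two big ones, out of
    three. *)
Lemma missing_big u v : u \in small -> v \in small -> adj u v ->
  (forall y, y \in small -> adj u y -> y = v) ->
  exists2 x, x \in big & forall y, y \in big -> adj u y = (y != x).
Proof.
move=> uT vT uv only_v.
have : #|big :\: nb u| == 1.
  have := cardsID (nb u) big; have := cardsID big (nb u).
  have -> : nb u :\: big = [set v].
    apply/setP => y; rewrite in_setD -smallE in_set1 [y \in nb u]inE.
    apply/andP/eqP => [[yT]|->].
      exact: only_v.
    by [].
  by rewrite deg_small // cards1 setIC big3; clear; lia.
case/cards1P => x E; exists x.
  by have := set11 x; rewrite -E inE => /andP[].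
by move=> y yF; move/setP/(_ y): E; rewrite !inE -bigE yF andbT => <-; rewrite negbK.
Qed.

(** With [uv] the only edge between small vertices, let [c] be the big vertex
    that [u] misses and [a] the one that [v] misses.  They differ, as otherwise
    the other two big vertices would cut [u] and [v] off.  Then [u] is the
    vertex that subdivides the edge from [a] to [v] and that is joined to the
    third big vertex [b]. *)
Lemma iso_kperp : arcs small small = 2 -> isomorphic G (kperp (#|G| - 4)).
Proof.
move=> t2; have [||u [v [uT vT uv uniq_uv]]] := @arcs2_edge small; rewrite ?t2 //.
have nuv : u != v by apply: contraTneq uv => ->; rewrite adj_irrefl.
have only_v y : y \in small -> adj u y -> y = v.
  by move=> yT uy; case: (uniq_uv u y) => // -[e1 e2] //; rewrite e1 eqxx in nuv.
have only_u y : y \in small -> adj v y -> y = u.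
  move=> yT vy; case: (uniq_uv v y) => // -[e1 e2] //.
  by rewrite -e1 eqxx in nuv.
have vu : adj v u by rewrite adj_sym.
have [c cF cP] := missing_big uT vT uv only_v.
have [a aF aP] := missing_big vT uT vu only_u.
have ac : a != c.
  apply/eqP => e; have : 3 <= #|big :\ c|.
    have cuv : closed [set u; v].
      split; first by rewrite subUset !sub1set uT.
      move=> x y; rewrite in_set2 => xD yD xy; apply: contraNT yD.
      rewrite -smallE in_set2 => yT.
      case/orP: xD xy => /eqP-> => [/(only_v y yT)|/(only_u y yT)] ->.
        by rewrite eqxx orbT.
      by rewrite eqxx.
    apply: (closed_attach (b := c) cuv) => //.
    - by apply/set0Pn; exists u; rewrite !inE eqxx.
    - exact: subsetDl.
    - by rewrite !inE eqxx.
    - move=> x y; rewrite in_set2 in_setD1 => xD yF xy; rewrite yF andbT.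
      by case/orP: xD xy => /eqP->; [rewrite cP | rewrite aP // e].
  by have := cardsD1 c big; rewrite cF big3; clear; lia.
have /cards1P[b E] : #|big :\ c :\ a| == 1.
  have := cardsD1 c big; have := cardsD1 a (big :\ c).
  by rewrite in_setD1 ac aF cF big3; clear; lia.
have : b \in big :\ c :\ a by rewrite E set11.
rewrite !in_setD1 => /and3P[ba bc bF].
pose R := small :\ u :\ v.
have cR : #|R| = #|G| - 5.
  have := cardsD1 u small; have := cardsD1 v (small :\ u); have := card_small.
  by rewrite in_setD1 eq_sym nuv uT vT big3 -/R; clear; lia.
have n5 : 5 <= #|G|.
  have := cardsD1 u small; have := cardsD1 v (small :\ u); have := card_small.
  by rewrite in_setD1 eq_sym nuv uT vT big3; clear; lia.
pose bs := [:: a; b; c]; pose ss := v :: enum R.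
have sz : size ss = #|G| - 4 by rewrite /ss [size _]/= -cardE cR; move: n5; clear; lia.
pose g (x : kperp (#|G| - 4)) : G := match x with
  | None => u
  | Some (inl i) => nth a bs i
  | Some (inr j) => nth v ss j end.
have Rsm r : r \in R -> [/\ r \in small, r != u & r != v].
  by rewrite !in_setD1 => /and3P[].
have gl (i : 'I_3) : g (Some (inl i)) \in big.
  by case: i => [[|[|[|]]]].
have ltj (j : 'I_(#|G| - 4)) : j < size ss by rewrite sz.
have gr0 (j : 'I_(#|G| - 4)) : j = 0 :> nat -> g (Some (inr j)) = v.
  by rewrite /g => ->.
have gr1 (j : 'I_(#|G| - 4)) : j != 0 :> nat -> g (Some (inr j)) \in R.
  rewrite /g; have := ltj j; case: (nat_of_ord j) => // k lt _ /=.
  by rewrite -mem_enum mem_nth.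
have gr (j : 'I_(#|G| - 4)) : g (Some (inr j)) \in small /\ g (Some (inr j)) != u.
  have [/gr0 ->|/gr1/Rsm[]//] := eqVneq (j : nat) 0.
  by rewrite vT eq_sym.
have ubs : uniq bs by rewrite /= !inE negb_or eq_sym ba ac bc.
have uss : uniq ss by rewrite /= enum_uniq andbT mem_enum !inE eqxx.
have nadj r y : r \in R -> y \in small -> adj r y = false.
  move=> /Rsm[rT ru rv] yT; apply/negP => ry.
  by case: (uniq_uv r y rT yT ry) => -[e _]; rewrite e eqxx in ru rv.
have radj r y : r \in R -> y \in big -> adj r y.
  move=> rR yF; have rT : r \in small by case: (Rsm r rR).
  have : nb r = big.
    apply/eqP; rewrite eqEcard big3 deg_small // leqnn andbT.
    apply/subsetP => z; rewrite inE; apply: contraLR; rewrite -smallE => zT.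
    by rewrite nadj.
  by move/setP/(_ y); rewrite yF inE.
have gN (i : 'I_3) : adj u (g (Some (inl i))) = (i == 0 :> nat) || (i == 1 :> nat).
  by rewrite cP //; case: i => [[|[|[|//]]] ?] /=; rewrite ?ac ?bc ?eqxx.
have gNr (j : 'I_(#|G| - 4)) : adj u (g (Some (inr j))) = (j == 0 :> nat).
  have [/gr0 ->|/gr1 jR] := eqVneq (j : nat) 0; first by rewrite uv.
  by rewrite adj_sym nadj.
have glr (i : 'I_3) (j : 'I_(#|G| - 4)) :
    adj (g (Some (inr j))) (g (Some (inl i))) =
    ~~ ((i == 0 :> nat) && (j == 0 :> nat)).
  have [/gr0 ->|/gr1 jR] := eqVneq (j : nat) 0; last by rewrite radj // andbF.
  rewrite aP // andbT; case: i => [[|[|[|//]]] ?] /=; rewrite ?eqxx ?ba //.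
  by rewrite eq_sym.
have grr (j j' : 'I_(#|G| - 4)) :
    adj (g (Some (inr j))) (g (Some (inr j'))) = false.
  have [jT ju] := gr j; have [jT' ju'] := gr j'.
  apply/negP => jj; case: (uniq_uv _ _ jT jT' jj) => -[e1 e2].
    by rewrite e1 eqxx in ju.
  by rewrite e2 eqxx in ju'.
have ug (i : 'I_3) : u <> g (Some (inl i)).
  by move=> e; move: uT; rewrite smallE e gl.
have lrg (i : 'I_3) (j : 'I_(#|G| - 4)) : g (Some (inl i)) <> g (Some (inr j)).
  by move=> e; have [] := gr j; rewrite smallE -e gl.
have urg (j : 'I_(#|G| - 4)) : u <> g (Some (inr j)).
  by move=> e; have [_] := gr j; rewrite -e eqxx.
apply: (@iso_of_embedding _ g) => [[[i|j]|] [[i'|j']|]|| [[i|j]|] [[i'|j']|]] //.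
- move/eqP; rewrite (nth_uniq a (s := bs)) //; first by move/eqP/val_inj->.
- by move/lrg.
- by move/esym/ug.
- by move/esym/lrg.
- move/eqP; rewrite (nth_uniq v (s := ss)) //; first by move/eqP/val_inj->.
- by move/esym/urg.
- by move/ug.
- by move/urg.
- have -> : #|kperp (#|G| - 4)| = (3 + (#|G| - 4)).+1.
    by rewrite card_option card_sum !card_ord.
  by move: n5; clear; lia.
- by rewrite (arcs_eq0 big_indep).
- by rewrite adj_sym glr.
- by rewrite adj_sym gN.
- by rewrite adj_sym gNr.
- by rewrite adj_irrefl.
Qed.

End ThreeBig.

End Connectivity.

(** * Edge counts of the extremal graphs *)

Lemma isomorphic_edges (G H : sgraph) : isomorphic G H -> #|edges G| = #|edges H|.
Proof.
move=> [f [bij_f fA]]; apply/eqP; rewrite -(eqn_pmul2l (ltn0Sn 1)) !handshake_sum.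
apply/eqP; rewrite [RHS](reindex f) /=; last exact: onW_bij.
apply: eq_bigr => x _; rewrite [RHS](reindex f) /=; last exact: onW_bij.
by apply: eq_bigr => y _; rewrite fA.
Qed.

Lemma edges_biclique m p : #|edges (biclique m p)| = m * p.
Proof.
apply/eqP; rewrite -(eqn_pmul2l (ltn0Sn 1)) handshake_sum big_sumType /=; apply/eqP.
under eq_bigr do
  rewrite big_sumType /= big1_eq sum_nat_const card_ord muln1 add0n.
under [X in _ + X]eq_bigr do
  rewrite big_sumType /= big1_eq sum_nat_const card_ord muln1 addn0.
by rewrite !sum_nat_const !card_ord; lia.
Qed.

Lemma big_option (T : finType) (F : option T -> nat) :
  \sum_x F x = F None + \sum_x F (Some x).
Proof.
rewrite (perm_big (None :: map Some (index_enum T))) ?big_cons ?big_map //.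
apply: uniq_perm; rewrite ?index_enum_uniq //= ?map_inj_uniq ?index_enum_uniq.
- by rewrite andbT; apply/mapP => -[].
- by move=> x y [].
by case=> [x|]; rewrite !mem_index_enum // inE mem_map ?mem_index_enum // => y z [].
Qed.

Lemma edges_kperp p : 0 < p -> #|edges (kperp p)| = 3 * p + 2.
Proof.
case: p => // p _; apply/eqP; rewrite -(eqn_pmul2l (ltn0Sn 1)) handshake_sum.
have sumE (f : kperp p.+1 -> nat) : \sum_x f x =
    f None + (\sum_(i < 3) f (Some (inl i)) +
      (f (Some (inr ord0)) + \sum_(j < p) f (Some (inr (lift ord0 j))))).
  by rewrite big_option big_sumType /= [X in _ + (_ + X)]big_ord_recl.
have degl (i : 'I_3) : \sum_y adj (Some (inl i) : kperp p.+1) y =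
    ((i == 0 :> nat) || (i == 1 :> nat)) + (~~ (i == 0 :> nat) + p).
  rewrite sumE /= big1_eq andbT; under eq_bigr do rewrite andbF.
  by rewrite sum_nat_const card_ord muln1.
have degr (j : 'I_p) : \sum_y adj (Some (inr (lift ord0 j)) : kperp p.+1) y = 3.
  by rewrite sumE /= big1_eq !big_ord_recl big_ord0.
rewrite sumE (eq_bigr _ (fun i _ => degl i)) (eq_bigr _ (fun j _ => degr j)).
rewrite !sumE /= !big_ord_recl !big_ord0 /= !big1_eq sum_nat_const card_ord.
by rewrite /bump /=; lia.
Qed.

Theorem theorem4p6 (G : sgraph) (n : nat)
    (hG : minimally_three_connected G) (hn : #|G| = n) (n7 : 7 <= n) :
  [/\ #|edges G| <= 3 * n - 9,
      8 <= n -> (#|edges G| = 3 * n - 9 <-> isomorphic G (biclique 3 (n - 3))) &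
      9 <= n -> (#|edges G| = 3 * n - 10 <-> isomorphic G (kperp (n - 4)))].
Proof.
have [G3 crit] := hG; subst n.
have toK : isomorphic G (biclique 3 (#|G| - 3)) -> #|edges G| = 3 * #|G| - 9.
  by move/isomorphic_edges->; rewrite edges_biclique; clear; lia.
have toP : isomorphic G (kperp (#|G| - 4)) -> #|edges G| = 3 * #|G| - 10.
  move/isomorphic_edges->; rewrite edges_kperp; move: n7; clear; lia.
have [[f3 ff0]|few] := edges_shape G3 crit n7; last first.
  move: few n7; case: (leqP 11 (_ + 2)) => [n9|n8] few n7.
    split; first by move: few; clear; lia.
      by split=> // e; exfalso; move: few e n7; clear; lia.
    by split=> // e; exfalso; move: few e n7; clear; lia.
  split; first by move: few n7; clear; lia.
    by move=> m8; split=> // e; exfalso; move: few e m8; clear; lia.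
  by move=> n9; exfalso; move: n8 n9; clear; lia.
have ec := edge_count G3; have c := card_small G.
rewrite ff0 addn0 in ec; rewrite f3 in c.
split; first by move: ec c; clear; lia.
  split=> // e; apply: iso_biclique => //.
  by move: ec c e n7; clear; lia.
split=> // e; apply: iso_kperp => //.
by move: ec c e n7; clear; lia.
Qed.
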